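(* Let $(X,\sigma,\tau)$ be a (non-degenerate) solution, let $(G,+,0)$ be an abelian group, let $n\in\mathbb{N}\cup\{\infty\}$, and let $\mathbf{c}=(c_i)_{i\in\mathbb{Z}_n}$, $\mathbf{d}=(d_i)_{i\in\mathbb{Z}_n}$ be sequences in $G$ with $c_0=d_0=0$ and $G=\langle c_i,d_i\mid i\in\mathbb{Z}_n\rangle$. Then $(X,\sigma,\tau)$ is a homomorphic image of $\mathcal{S}(G\times\mathbb{Z}_n^2,\mathbf{c},\mathbf{d})$ if and only if the following conditions hold: 1. $(X,\sigma,\tau)$ is indecomposable; 2. the multipermutation level of $(X,\sigma,\tau)$ is at most $2$; 3. the order $o(U_X)$ of the permutation $U_X$ divides $n$; 4. the order $o(T_X)$ of the permutation $T_X$ divides $n$; 5. for some $e\in X$, there exists a surjective group homomorphism $\varphi:G\to\mathrm{Dis}(X)/\mathrm{Dis}(X)_e$ such that, for all $i\in\mathbb{Z}_n$, $\varphi(c_i)=\sigma_{U_X^{-i}(e)}\sigma_e^{-1}\mathrm{Dis}(X)_e$ and $\varphi(d_i)=\tau_{T_X^{i}(e)}\tau_e^{-1}\mathrm{Dis}(X)_e$.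
   Context: $\mathbb{N}$ denotes the positive integers; $\mathbb{Z}_n=\mathbb{Z}/n\mathbb{Z}$ for $n\in\mathbb{N}$ and $\mathbb{Z}_\infty=\mathbb{Z}$. Convention: every (finite or infinite) order divides $\infty$. A solution $(X,\sigma,\tau)$ is a nonempty set $X$ (of arbitrary cardinality) with families of bijections $\sigma_x,\tau_x:X\to X$ ($x\in X$) such that $r(x,y)=(\sigma_x(y),\tau_y(x))$ satisfies $(\mathrm{id}\times r)(r\times\mathrm{id})(\mathrm{id}\times r)=(r\times\mathrm{id})(\mathrm{id}\times r)(r\times\mathrm{id})$ on $X^3$. It is indecomposable if $\langle\sigma_x,\tau_x: x\in X\rangle$ acts transitively on $X$. Put $x\approx y$ iff $\sigma_x=\sigma_y$ and $\tau_x=\tau_y$. The operations induced on $X/{\approx}$ are well defined and give a solution $\mathrm{Ret}(X)$. $X$ has multipermutation level at most $2$ if $|\mathrm{Ret}(\mathrm{Ret}(X))|=1$. $U_X(x)=\sigma_x^{-1}(x)$ and $T_X(x)=\tau_x^{-1}(x)$; these are commuting permutations of $X$. $\mathrm{Dis}(X)=\langle\sigma_x\sigma_y^{-1},\tau_x\tau_y^{-1}:x,y\in X\rangle$, and $\mathrm{Dis}(X)_e$ is the stabilizer of $e$ in $\mathrm{Dis}(X)$. For solutions of multipermutation level at most $2$ the group $\mathrm{Dis}(X)$ is abelian. $\mathcal{S}(G\times\mathbb{Z}_n^2,\mathbf{c},\mathbf{d})$ is the solution $(Y,\lambda,\rho)$ on $Y=G\times\mathbb{Z}_n^2$ given by $\lambda_{(a,i,i')}((b,j,j'))=(b+c_{i-i'+j'-j-1},j+1,j')$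 and $\rho_{(a,i,i')}((b,j,j'))=(b+d_{i-i'+j'-j+1},j,j'+1)$. A homomorphism $\Phi:(Y,\lambda,\rho)\to(X,\sigma,\tau)$ is a map with $\Phi\lambda_y=\sigma_{\Phi(y)}\Phi$ and $\Phi\rho_y=\tau_{\Phi(y)}\Phi$ for all $y\in Y$; $X$ is a homomorphic image of $Y$ if there is a surjective homomorphism $Y\to X$. *)

(* Defs.v *)
From HB Require Import structures.
From mathcomp Require Import all_boot all_order all_algebra.
From mathcomp Require Import generic_quotient.
From mathcomp Require Import boolp classical_sets.

Set Implicit Arguments.
Unset Strict Implicit.
Unset Printing Implicit Defensive.

Import GRing.Theory.

Local Open Scope classical_set_scope.
Local Open Scope quotient_scope.
Local Open Scope ring_scope.

Record Sym (X : Type) := MkSym {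
  sym_fun :> X -> X;
  sym_inv : X -> X;
  sym_funK : cancel sym_fun sym_inv;
  sym_invK : cancel sym_inv sym_fun
}.

Section SymGroup.
Variable X : Type.
Implicit Types f g h : Sym X.

Lemma symP f g : (forall x, f x = g x) -> f = g.
Proof.
case: f g => [f f' fK f'K] [g g' gK g'K] /= /funext fg.
move: fK f'K; rewrite fg => fK f'K.
have fg' : f' = g'.
  by apply/funext => x; rewrite -[in LHS](g'K x) fK.
move: fK f'K; rewrite fg' => fK f'K.
by congr MkSym; exact: Prop_irrelevance.
Qed.

Definition sym_one : Sym X := @MkSym X id id (fun=> erefl) (fun=> erefl).

Definition sym_opp f : Sym X := MkSym (sym_invK f) (sym_funK f).

(* The product is composition, so that permutations act on the left. *)
Definition sym_mul f g : Sym X :=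
  MkSym (can_comp (sym_funK f) (sym_funK g))
        (can_comp (sym_invK g) (sym_invK f)).

HB.instance Definition _ := gen_eqMixin (Sym X).
HB.instance Definition _ := gen_choiceMixin (Sym X).

Lemma sym_mulA : associative sym_mul.
Proof. by move=> f g h; apply: symP. Qed.
Lemma sym_mul1 : left_id sym_one sym_mul.
Proof. by move=> f; apply: symP. Qed.
Lemma sym_mulr1 : right_id sym_one sym_mul.
Proof. by move=> f; apply: symP. Qed.
Lemma sym_mulV : left_inverse sym_one sym_opp sym_mul.
Proof. by move=> f; apply: symP => x; apply: sym_funK. Qed.
Lemma sym_mulrV : right_inverse sym_one sym_opp sym_mul.
Proof. by move=> f; apply: symP => x; apply: sym_invK. Qed.

HB.instance Definition _ :=
  isGroup.Build (Sym X) sym_mulA sym_mul1 sym_mulr1 sym_mulV sym_mulrV.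

Lemma symM f g x : (f * g)%g x = f (g x). Proof. by []. Qed.
Lemma symK f : cancel f (f^-1)%g. Proof. exact: sym_funK. Qed.
Lemma symVK f : cancel (f^-1)%g f. Proof. exact: sym_invK. Qed.
Lemma sym_inj f : injective f. Proof. exact: can_inj (symK f). Qed.

End SymGroup.

Section Groups.
Variable gT : groupType.
Implicit Types (g : gT) (A B : set gT).

Definition is_subgroup A :=
  A 1%g /\ forall g h, A g -> A h -> A (g^-1 * h)%g.

Definition subgroup_gen A : set gT := smallest is_subgroup A.

Definition set_mul A B : set gT := [set (g * h)%g | g in A & h in B].

Definition left_coset g B : set gT := [set (g * h)%g | h in B].

Definition left_cosets A B : set (set gT) := [set left_coset g B | g in A].

Definition zexpg g (k : int) : gT :=
  match k with
  | Posz m => (g ^+ m)%g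
  | Negz m => (g ^- m.+1)%g
  end.

(* Orders live in the positive integers extended by infinity, which is [None]. *)
Definition ext_order g : option nat :=
  match pselect (exists k, (0 < k)%N && (g ^+ k == 1)%g) with
  | left ex_k => Some (ex_minn ex_k)
  | right _ => None
  end.

End Groups.

(* Divisibility with the convention that everything divides infinity. *)
Definition order_dvd (o n : option nat) : bool :=
  match n, o with
  | None, _ => true
  | Some m, Some k => (k %| m)%N
  | Some _, None => false
  end.

Definition is_add_subgroup (G : zmodType) (A : set G) :=
  A 0 /\ forall x y, A x -> A y -> A (x - y).

Definition add_subgroup_gen (G : zmodType) (A : set G) : set G :=
  smallest (@is_add_subgroup G) A.

(* [Some m] is only meaningful for [m > 0]; then ['I_m.-1.+1] is the additive
   group of integers modulo [m], including the trivial group for [m = 1]. *)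
Definition Zn (n : option nat) : zmodType :=
  match n with
  | Some m => 'I_m.-1.+1
  | None => int
  end.

Definition Zn_one (n : option nat) : Zn n :=
  match n return Zn n with
  | Some m => inZp 1
  | None => 1
  end.

Definition Zn_class (n : option nat) (k : int) : Zn n := Zn_one n *~ k.

Definition map12 (X : Type) (s t : X -> X -> X) (w : X * X * X) : X * X * X :=
  let: (x, y, z) := w in (s x y, t y x, z).

Definition map23 (X : Type) (s t : X -> X -> X) (w : X * X * X) : X * X * X :=
  let: (x, y, z) := w in (x, s y z, t z y).

Definition yang_baxter (X : Type) (s t : X -> X -> X) :=
  forall w, map23 s t (map12 s t (map23 s t w)) =
            map12 s t (map23 s t (map12 s t w)).

Record solution := Solution {
  carrier :> Type;
  sigma : carrier -> Sym carrier;
  tau : carrier -> Sym carrier;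
  carrier_inhabited : inhabited carrier;
  sigma_tau_yb : yang_baxter sigma tau
}.

Arguments sigma {s}.
Arguments tau {s}.

Lemma yang_baxterE (X : Type) (s t : X -> X -> X) :
  (forall x y z, s x (s y z) = s (s x y) (s (t y x) z)) ->
  (forall x y z, t z (t y x) = t (t z y) (t (s y z) x)) ->
  (forall x y z, t (s (t y x) z) (s x y) = s (t (s y z) x) (t z y)) ->
  yang_baxter s t.
Proof. by move=> h1 h2 h3 [[x y] z] /=; rewrite (h1 x) -(h2 x) -(h3 x). Qed.

Section SolutionTheory.
Variable X : solution.
Implicit Types x y z u v : X.

Lemma yb_sigma x y z :
  sigma x (sigma y z) = sigma (sigma x y) (sigma (tau y x) z).
Proof. by case: (sigma_tau_yb (x, y, z)). Qed.

Lemma yb_tau x y z : tau z (tau y x) = tau (tau z y) (tau (sigma y z) x).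
Proof. by case: (sigma_tau_yb (x, y, z)). Qed.

Lemma yb_mixed x y z :
  tau (sigma (tau y x) z) (sigma x y) = sigma (tau (sigma y z) x) (tau z y).
Proof. by case: (sigma_tau_yb (x, y, z)). Qed.

End SolutionTheory.

Lemma opposite_yb (X : solution) :
  yang_baxter (fun x : X => tau x) (fun x : X => sigma x).
Proof.
apply: yang_baxterE => x y z; [exact: yb_tau|exact: yb_sigma|].
exact: (esym (yb_mixed z y x)).
Qed.

Definition opposite (X : solution) : solution :=
  @Solution X tau sigma (carrier_inhabited X) (@opposite_yb X).

Section UT.
Variable X : solution.
Implicit Types x y z u v : X.

Definition U_fun x : X := (sigma x)^-1%g x.
Definition T_fun x : X := (tau x)^-1%g x.

(* This is the inverse of [U_fun] for every solution: neither finiteness of [X]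
   nor bijectivity of r is needed. *)
Definition U_inv z : X := sigma (T_fun z) z.

Lemma sigma_U_inv z : sigma (U_inv z) = sigma (T_fun z).
Proof.
apply: symP => w; rewrite -(symVK (sigma z) w).
by rewrite [RHS]yb_sigma [tau z _]symVK.
Qed.

Lemma U_invK : cancel U_inv U_fun.
Proof. by move=> z; rewrite /U_fun sigma_U_inv symK. Qed.

Lemma U_fun_tau x v :
  U_fun (tau v x) = tau ((sigma (U_fun x))^-1%g v) (U_fun x).
Proof.
set z := U_fun x.
have xz : sigma x z = x by rewrite /z /U_fun symVK.
set w := ((sigma z)^-1)%g v.
have zw : sigma z w = v by rewrite /w symVK.
have qz : sigma (tau z x) w = v.
  apply: (@sym_inj _ (sigma x)).
  by have := yb_sigma x z w; rewrite xz zw.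
have := yb_mixed x z w; rewrite qz xz zw => h.
by rewrite /U_fun {2}h symK.
Qed.

Lemma U_fun_inj : injective U_fun.
Proof.
move=> x x' e.
have xz : sigma x (U_fun x) = x by rewrite /U_fun symVK.
have x'z : sigma x' (U_fun x') = x' by rewrite /U_fun symVK.
have e2 : U_fun (tau (U_fun x) x) = U_fun (tau (U_fun x) x').
  by rewrite !U_fun_tau e.
have s1 y : sigma y (U_fun y) = y -> sigma (tau (U_fun y) y) = sigma (U_fun y).
  move=> yz; apply: symP => w; apply: (@sym_inj _ (sigma y)).
  by have := yb_sigma y (U_fun y) w; rewrite yz.
apply: (@sym_inj _ (tau (U_fun x))).
have hq y : tau (U_fun y) y
    = sigma (U_fun y) (U_fun (tau (U_fun y) y)).
  by rewrite -s1; rewrite /U_fun ?symVK.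
rewrite (hq x) e2 e; exact: esym (hq x').
Qed.

Lemma U_funK : cancel U_fun U_inv.
Proof. by move=> x; apply: U_fun_inj; rewrite U_invK. Qed.

Definition U_perm : Sym X := MkSym U_funK U_invK.

End UT.

Definition T_perm (X : solution) : Sym X :=
  @MkSym X (@T_fun X) (@U_inv (opposite X))
    (@U_funK (opposite X)) (@U_invK (opposite X)).

Lemma U_permE (X : solution) (x : X) : U_perm X x = (sigma x)^-1%g x.
Proof. by []. Qed.

Lemma T_permE (X : solution) (x : X) : T_perm X x = (tau x)^-1%g x.
Proof. by []. Qed.

Section Ret.
Variable X : solution.
Implicit Types x y z u v : {classic X}.

Definition ret_rel : rel {classic X} :=
  fun x y => (sigma x == sigma y) && (tau x == tau y).

Lemma ret_rel_refl : reflexive ret_rel.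
Proof. by move=> x; rewrite /ret_rel !eqxx. Qed.
Lemma ret_rel_sym : symmetric ret_rel.
Proof. by move=> x y; rewrite /ret_rel eq_sym [tau x == _]eq_sym. Qed.
Lemma ret_rel_trans : transitive ret_rel.
Proof.
by move=> y x z /andP[/eqP xy /eqP xy']; rewrite /ret_rel xy xy'.
Qed.

Canonical ret_equiv := EquivRel ret_rel ret_rel_refl ret_rel_sym ret_rel_trans.

Lemma ret_relP x y : reflect (sigma x = sigma y /\ tau x = tau y) (ret_rel x y).
Proof. by apply: (iffP andP) => -[/eqP ? /eqP ?]. Qed.

Lemma ret_rel_sigma x u v : ret_rel (sigma x u) (sigma x v) = ret_rel u v.
Proof.
apply/ret_relP/ret_relP => -[es et].
- have q : tau u x = tau v x.
    have := U_invK x; set y := U_inv x => Uy.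
    have := U_fun_tau y (sigma x u); rewrite Uy symK => <-.
    by have := U_fun_tau y (sigma x v); rewrite Uy symK => <-; rewrite et.
  split; apply: symP => z.
    by apply: (@sym_inj _ (sigma x)); rewrite (yb_sigma x u) (yb_sigma x v) es q.
  have hz w : tau u (tau x w) = tau v (tau x w).
    by rewrite yb_tau et q -yb_tau.
  by rewrite -(symVK (tau x) z) hz.
- split; apply: symP => z.
    rewrite -(symVK (sigma (tau u x)) z) -(yb_sigma x u) es et.
    exact: yb_sigma.
  apply: (@sym_inj _ (tau (tau u x))).
  by rewrite -(yb_tau z x u) et; exact: yb_tau.
Qed.

End Ret.

Lemma ret_rel_opposite (X : solution) (x y : X) :
  @ret_rel (opposite X) x y = ret_rel x y.
Proof. exact: andbC. Qed.

Lemma ret_rel_tau (X : solution) (x u v : X) :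
  ret_rel (tau x u) (tau x v) = ret_rel u v.
Proof.
rewrite -(ret_rel_opposite u) -(@ret_rel_sigma (opposite X) x u v).
by rewrite ret_rel_opposite.
Qed.

Section RetSolution.
Variable X : solution.

Definition ret_carrier : Type := {eq_quot (@ret_equiv X)}.

Definition ret_pi (x : X) : ret_carrier := \pi_{eq_quot (@ret_equiv X)} x.

Lemma ret_piP (x y : X) :
  ret_pi x = ret_pi y <-> (sigma x = sigma y /\ tau x = tau y).
Proof.
split=> [/eqmodP/ret_relP //|h].
by apply/eqmodP/ret_relP.
Qed.

Definition ret_repr (a : ret_carrier) : X := @repr {classic X} {eq_quot (@ret_equiv X)} a.

Lemma ret_reprK : cancel ret_repr ret_pi.
Proof. exact: reprK. Qed.

Lemma ret_pi_rel (x y : X) : ret_rel x y <-> ret_pi x = ret_pi y.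
Proof. by split=> [/eqmodP|/eqmodP]. Qed.

Section Lift.
Variables (f : Sym X) (f_rel : forall u v, ret_rel (f u) (f v) = ret_rel u v).

Definition lift_fun (a : ret_carrier) := ret_pi (f (ret_repr a)).
Definition lift_inv (a : ret_carrier) := ret_pi (f^-1%g (ret_repr a)).

Lemma lift_funE x : lift_fun (ret_pi x) = ret_pi (f x).
Proof. by apply/ret_pi_rel; rewrite f_rel; apply/ret_pi_rel; rewrite ret_reprK. Qed.

Lemma lift_invE x : lift_inv (ret_pi x) = ret_pi (f^-1%g x).
Proof.
by apply/ret_pi_rel; rewrite -f_rel !symVK; apply/ret_pi_rel; rewrite ret_reprK.
Qed.

Lemma lift_funK : cancel lift_fun lift_inv.
Proof. by move=> a; rewrite lift_invE symK ret_reprK. Qed.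

Lemma lift_invK : cancel lift_inv lift_fun.
Proof. by move=> a; rewrite lift_funE symVK ret_reprK. Qed.

Definition sym_lift : Sym ret_carrier := MkSym lift_funK lift_invK.

End Lift.

Definition ret_sigma (a : ret_carrier) : Sym ret_carrier :=
  sym_lift (ret_rel_sigma (ret_repr a)).
Definition ret_tau (a : ret_carrier) : Sym ret_carrier :=
  sym_lift (@ret_rel_tau X (ret_repr a)).

Lemma ret_sigmaE (x y : X) :
  ret_sigma (ret_pi x) (ret_pi y) = ret_pi (sigma x y).
Proof.
have [/= e _] := (ret_piP _ _).1 (ret_reprK (ret_pi x)).
by rewrite -e; apply: lift_funE; exact: ret_rel_sigma.
Qed.

Lemma ret_tauE (x y : X) : ret_tau (ret_pi x) (ret_pi y) = ret_pi (tau x y).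
Proof.
have [/= _ e] := (ret_piP _ _).1 (ret_reprK (ret_pi x)).
by rewrite -e; apply: lift_funE; exact: ret_rel_tau.
Qed.

Lemma ret_inhabited : inhabited ret_carrier.
Proof. by case: (carrier_inhabited X) => x; exists; exact: ret_pi x. Qed.

Lemma ret_yb : yang_baxter ret_sigma ret_tau.
Proof.
move=> [[a b] c]; rewrite -(ret_reprK a) -(ret_reprK b) -(ret_reprK c).
have := sigma_tau_yb (ret_repr a, ret_repr b, ret_repr c).
rewrite /map12 /map23 !(ret_sigmaE, ret_tauE).
by case=> -> -> ->.
Qed.

Definition Ret : solution := Solution ret_inhabited ret_yb.

End RetSolution.

Definition mp_level_le2 (X : solution) :=
  exists p : Ret (Ret X), [set: Ret (Ret X)] = [set p].

Definition indecomposable (X : solution) :=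
  forall x y : X, exists2 g : Sym X,
    subgroup_gen (range (@sigma X) `|` range (@tau X)) g & g x = y.

Definition Dis (X : solution) : set (Sym X) :=
  subgroup_gen
    [set g | exists x y : X,
       g = (sigma x * (sigma y)^-1)%g \/ g = (tau x * (tau y)^-1)%g].

Arguments Dis : clear implicits.

Definition Dis_stab (X : solution) (e : X) : set (Sym X) :=
  [set g | Dis X g /\ g e = e].

(* A surjective homomorphism from [G] to the quotient of [A] by [B]: its values
   are the left cosets of [B] in [A], multiplied as subsets.  When [B] is a
   normal subgroup of [A] this product is the group law of the quotient. *)
Definition surjective_hom_to_quotient
    (G : zmodType) (gT : groupType) (A B : set gT) (phi : G -> set gT) :=
  range phi = left_cosets A B /\
  forall a b : G, phi (a + b) = set_mul (phi a) (phi b).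

Definition is_hom (Y X : solution) (Phi : Y -> X) :=
  (forall y z, Phi (sigma y z) = sigma (Phi y) (Phi z)) /\
  (forall y z, Phi (tau y z) = tau (Phi y) (Phi z)).

Definition homomorphic_image (X Y : solution) :=
  exists Phi : Y -> X, is_hom Phi /\ (forall x, exists y, Phi y = x).

Section S.
(* Only an abelian group of indices with a distinguished element [one] is needed
   for the solution axioms; [S_solution] below takes Z_n with its generator 1. *)
Variables (G I : zmodType) (one : I) (c d : I -> G).

Definition S_carrier : Type := (G * I * I)%type.

Definition S_sigma_fun (x y : S_carrier) : S_carrier :=
  let: (_, i, i') := x in let: (b, j, j') := y in
  (b + c (i - i' + j' - j - one), j + one, j').

Definition S_sigma_inv (x y : S_carrier) : S_carrier :=
  let: (_, i, i') := x in let: (b, j, j') := y in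
  (b - c (i - i' + j' - j), j - one, j').

Definition S_tau_fun (x y : S_carrier) : S_carrier :=
  let: (_, i, i') := x in let: (b, j, j') := y in
  (b + d (i - i' + j' - j + one), j, j' + one).

Definition S_tau_inv (x y : S_carrier) : S_carrier :=
  let: (_, i, i') := x in let: (b, j, j') := y in
  (b - d (i - i' + j' - j), j, j' - one).

Lemma S_sigma_funK x : cancel (S_sigma_fun x) (S_sigma_inv x).
Proof.
case: x => [[a i] i'] [[b j] j'] /=.
by rewrite [- (j + one)]opprD !addrA addrK addrK.
Qed.

Lemma S_sigma_invK x : cancel (S_sigma_inv x) (S_sigma_fun x).
Proof.
case: x => [[a i] i'] [[b j] j'] /=.
by rewrite opprB addrA [_ - j - one]addrAC addrK !subrK.
Qed.

Lemma S_tau_funK x : cancel (S_tau_fun x) (S_tau_inv x).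
Proof.
case: x => [[a i] i'] [[b j] j'] /=.
by rewrite !addrA [_ + one - j]addrAC addrK addrK.
Qed.

Lemma S_tau_invK x : cancel (S_tau_inv x) (S_tau_fun x).
Proof.
case: x => [[a i] i'] [[b j] j'] /=.
by rewrite !addrA [_ - one - j]addrAC !subrK.
Qed.

Definition S_sigma (x : S_carrier) : Sym S_carrier :=
  MkSym (S_sigma_funK x) (S_sigma_invK x).
Definition S_tau (x : S_carrier) : Sym S_carrier :=
  MkSym (S_tau_funK x) (S_tau_invK x).

Lemma S_yb : yang_baxter S_sigma S_tau.
Proof.
have pull (w i j k : I) : w + one - i + j - k = w - i + j - k + one.
  by rewrite [_ + one - i]addrAC [_ + one + j]addrAC [_ + one - k]addrAC.
have push (w i j k : I) : w - (i + one) + j - k = w - i + j - k - one.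
  by rewrite opprD addrA [_ - one + j]addrAC [_ - one - k]addrAC.
have subk (w k : I) : w - (k + one) = w - k - one by rewrite opprD addrA.
apply: yang_baxterE.
- case=> [[a i] i'] [[b j] j'] [[e k] k'].
  rewrite /S_sigma /S_tau /= /S_sigma_fun /S_tau_fun.
  have -> : i - (i' + one) + k' - k - one = i - i' + k' - (k + one) - one.
    by rewrite push subk.
  have -> : j + one - j' + k' - (k + one) - one = j - j' + k' - k - one.
    by rewrite pull addrK subk.
  by rewrite [e + _ + _]addrAC.
- case=> [[a i] i'] [[b j] j'] [[e k] k'].
  rewrite /S_sigma /S_tau /= /S_sigma_fun /S_tau_fun.
  have -> : k + one - k' + i' - i + one = k - k' + (i' + one) - i + one.
    by rewrite pull addrA [_ + one - i]addrAC.
  have -> : j - (j' + one) + (i' + one) - i + one = j - j' + i' - i + one.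
    by rewrite push subrK addrA [_ + one - i]addrAC.
  by rewrite [a + _ + _]addrAC.
- case=> [[a i] i'] [[b j] j'] [[e k] k'].
  rewrite /S_sigma /S_tau /= /S_sigma_fun /S_tau_fun.
  have -> : k + one - k' + j' - (j + one) + one = k - k' + j' - j + one.
    by rewrite pull subk subrK.
  have -> : i - (i' + one) + (j' + one) - j - one = i - i' + j' - j - one.
    by rewrite push addrA [_ + one - j]addrAC addrK.
  by rewrite [b + _ + _]addrAC.
Qed.

Definition shift_solution : solution :=
  Solution (inhabits ((0, 0, 0) : S_carrier)) S_yb.

End S.

Definition S_solution (G : zmodType) (n : option nat) (c d : Zn n -> G) :
  solution := shift_solution (Zn_one n) c d.

(* Main.v *)
Require Import Defs.
From mathcomp Require Import all_boot all_order all_algebra.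
From mathcomp Require Import boolp classical_sets ring.

Set Implicit Arguments.
Unset Strict Implicit.
Unset Printing Implicit Defensive.

Import GRing.Theory.
Local Open Scope classical_set_scope.
Local Open Scope ring_scope.

(** Write x ~ y when x and y have the same image in the retraction, that is,
    when they act by the same sigma and the same tau.

    The proof rests on a coordinate system for a solution X of level at most
    two.  Level at most two means that the class of sigma_x(z) depends on z
    only, and so does the class of tau_x(z); evaluating at a convenient x, these
    are the classes of U^-1(z) and T^-1(z) ([mp_level_le2P], [ret_sigma_inv]).
    Since the action of a point depends on its class only, the Yang-Baxter
    equation then says that U and T are automorphisms of X ([U_Aut], [T_Aut]),
    so they commute, and they normalise Dis(X).  In every solution
    T^-1(z) ~ U(z) ([ret_T_inv]); at level at most two the elements of Dis(X)
    moreover fix every class ([Dis_ret]).  As sigma_x(z) differs from U^-1(z), and tau_x(z) from T^-1(z),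
    by an element of Dis(X), when X is indecomposable every point of X has the
    form U^-k T^-l h(e) with h in Dis(X) ([indecomposable_UT_shift]), and
    [sigma_UT_shift] and [tau_UT_shift] compute sigma and tau in these
    coordinates: they are the formulas that define S(G x Z_n^2, c, d), with
    sigma_{U^-i(e)} sigma_e^-1 in the place of c_i and
    tau_{T^i(e)} tau_e^-1 in the place of d_i.

    If the five conditions hold, the covering map is therefore
    (a, i, i') |-> U^-i T^-i' h(e) for any h in the coset phi(a)
    ([image_of_S]).  It is well defined: all elements of a coset of the
    stabiliser take the same value at e, and since the orders of U and T divide
    n, their powers are determined by exponents in Z_n.

    Conversely, let Phi be a homomorphism of S(G x Z_n^2, c, d) onto X, and put
    e = Phi(0,0,0).  On S itself U subtracts one from the second coordinate and T
    from the third (this is where c_0 = d_0 = 0 enters), which gives the two order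
    conditions.  Each element of Dis(X) acts on the points Phi(b,0,0) as
    b |-> b + t for some t in G ([Dis_translation]), and each t in G occurs
    because G is generated by the c_i and d_i ([translation_Dis]).  Hence
    phi(a) = {g in Dis(X) | g(e) = Phi(a,0,0)} is a coset of the stabiliser of
    e and depends homomorphically on a ([image_quotient_hom]). *)

(** * Subgroups and integer powers *)

Section GroupLemmas.
Variable gT : groupType.
Implicit Types (g h : gT) (A B : set gT).

Lemma subgroup_inv A g : is_subgroup A -> A g -> A (g^-1)%g.
Proof. by case=> A1 AVM Ag; rewrite -[(g^-1)%g]mulg1; apply: AVM. Qed.

Lemma subgroup_mul A g h : is_subgroup A -> A g -> A h -> A (g * h)%g.
Proof.
move=> sgA Ag Ah; rewrite -[g in X in A X]invgK.
by apply: sgA.2 => //; exact: subgroup_inv.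
Qed.

Lemma subgroup_genP A : is_subgroup (subgroup_gen A).
Proof.
split=> [B [[]] //|g h Ag Ah B sgB].
by apply: sgB.1.2; [exact: Ag|exact: Ah].
Qed.

Lemma subgroup_gen_min A B :
  is_subgroup B -> A `<=` B -> subgroup_gen A `<=` B.
Proof. exact: smallest_sub. Qed.

Lemma sub_subgroup_gen A : A `<=` subgroup_gen A.
Proof. exact: sub_gen_smallest. Qed.

Lemma zexpgS g k : zexpg g (k + 1) = (g * zexpg g k)%g.
Proof.
case: k => [m|[|m]]; rewrite /zexpg.
- by rewrite -PoszD addn1 expgS.
- by rewrite NegzE addNr /= expg1 mulgV.
- have -> : Negz m.+1 + 1 = Negz m by rewrite !NegzE -addn1 PoszD opprD addrNK.
  by rewrite [in RHS]expgSr invgM mulVKg.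
Qed.

Lemma zexpgD g k l : zexpg g (k + l) = (zexpg g k * zexpg g l)%g.
Proof.
elim/int_rec: k => [|m IH|m IH]; first by rewrite add0r mul1g.
  by rewrite -addn1 PoszD addrAC !zexpgS IH mulgA.
apply: (can_inj (mulKg g)); rewrite mulgA -!zexpgS -addrA [l + 1]addrC addrA.
by rewrite -addn1 PoszD opprD addrNK.
Qed.

Lemma zexpg1 g : zexpg g 1 = g. Proof. exact: expg1. Qed.

Lemma zexpgN g k : zexpg g (- k) = (zexpg g k)^-1%g.
Proof.
by apply: (can_inj (mulKg (zexpg g k))); rewrite -zexpgD subrr mulgV.
Qed.

Lemma zexpgV g k : zexpg g^-1%g k = zexpg g (- k).
Proof. by case: k => m; rewrite zexpgN /= expVgn. Qed.

Lemma zexpg_subgroup A g k : is_subgroup A -> A g -> A (zexpg g k).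
Proof.
move=> sgA Ag; elim/int_rec: k => [|m IH|m IH]; first exact: sgA.1.
  by rewrite -addn1 PoszD zexpgS; exact: subgroup_mul.
rewrite -addn1 PoszD opprD addrC zexpgD zexpgN zexpg1.
by apply: subgroup_mul => //; exact: subgroup_inv.
Qed.

Lemma zexpg_commute g h k : (g * h = h * g)%g ->
  (g * zexpg h k = zexpg h k * g)%g.
Proof.
pose C := [set x : gT | (g * x = x * g)%g]; apply: (@zexpg_subgroup C).
split=> [|x y]; rewrite /C/=; first by rewrite mulg1 mul1g.
move=> gx gy; apply: (can_inj (mulKg x)).
by rewrite mulgA -gx -!mulgA !mulVKg gy.
Qed.

Lemma expg_Some_order_dvd g m :
  (0 < m)%N -> order_dvd (ext_order g) (Some m) <-> (g ^+ m = 1)%g.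
Proof.
move=> m_gt0; rewrite /ext_order; case: pselect => [exk|nexk] /=; last first.
  by split=> // gm; case: nexk; exists m; rewrite m_gt0 gm eqxx.
case: ex_minnP => k /andP[k_gt0 /eqP gk] kmin.
split=> [/dvdnP[q ->]|gm]; first by rewrite mulnC expgnA gk expg1n.
have [r0|r_gt0] := posnP (m %% k); first exact/eqP.
have /kmin : (0 < m %% k)%N && (g ^+ (m %% k) == 1)%g.
  rewrite r_gt0; apply/eqP.
  rewrite -[RHS]gm [in RHS](divn_eq m k) mulnC.
  by rewrite expgnDr expgnA gk expg1n mul1g.
by rewrite leqNgt ltn_mod k_gt0.
Qed.

End GroupLemmas.

(** * Integers as representatives of residue classes *)

Section ResidueClasses.
Variable n : option nat.
Hypothesis n_pos : n <> Some 0%N.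

Lemma Zn_classD k l : Zn_class n (k + l) = Zn_class n k + Zn_class n l.
Proof. exact: mulrzDr. Qed.

Lemma Zn_classN k : Zn_class n (- k) = - Zn_class n k.
Proof. exact: mulrNz. Qed.

Lemma Zn_class1 : Zn_class n 1 = Zn_one n.
Proof. exact: mulr1z. Qed.

Lemma Zn_class0 : Zn_class n 0 = 0.
Proof. exact: mulr0z. Qed.

Lemma Zn_class_Some_nat m (k : nat) :
  Zn_class (Some m) k = inZp k :> 'I_m.-1.+1.
Proof.
rewrite /Zn_class /= -pmulrn Zp_mulrn; apply: val_inj => /=.
by rewrite modnMml mul1n.
Qed.

Lemma Zn_class_surj (i : Zn n) : exists k, Zn_class n k = i.
Proof.
case: n i => [m|] i; last by exists i; exact: intz.
by exists (Posz (i : 'I_m.-1.+1)); rewrite Zn_class_Some_nat; exact: valZpK.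
Qed.

(** This is the form in which the order conditions enter: they let elements of
    Z_n serve as exponents of g. *)
Lemma order_dvdP (gT : groupType) (g : gT) :
  order_dvd (ext_order g) n <->
  (forall k l, Zn_class n k = Zn_class n l -> zexpg g k = zexpg g l).
Proof.
case: n n_pos => [m|] m_pos; last first.
  by split=> // _ k l; rewrite /Zn_class /= !intz => ->.
have m_gt0 : (0 < m)%N by case: m m_pos.
have mE : m.-1.+1 = m by rewrite prednK.
rewrite expg_Some_order_dvd //; split=> [gm k l kl|gP].
  have nat_case (j : nat) : Zn_class (Some m) j = 0 -> (g ^+ j = 1)%g.
    rewrite Zn_class_Some_nat => /(congr1 val) /= /eqP.
    by rewrite mE => /dvdnP[q ->]; rewrite mulnC expgnA gm expg1n.
  have : Zn_class (Some m) (k - l) = 0.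
    by rewrite /Zn_class mulrzBr -/(Zn_class (Some m) k) kl subrr.
  suff class0 (j : int) : Zn_class (Some m) j = 0 -> zexpg g j = 1%g.
    by move=> /class0 kl1; rewrite -[k in LHS](subrK l) zexpgD kl1 mul1g.
  case: j => [j /nat_case //|j]; rewrite NegzE /Zn_class mulrNz zexpgN.
  by move=> /eqP; rewrite oppr_eq0 => /eqP/nat_case /= ->; rewrite invg1.
have -> : (g ^+ m)%g = zexpg g m by [].
rewrite (gP m 0) // Zn_class_Some_nat /Zn_class mulr0z.
by apply: val_inj; rewrite /= mE modnn.
Qed.

End ResidueClasses.

(** * Orbits of integer powers of permutations *)

(** Identifies integer powers of f along an orbit that is already known in
    closed form, with negative exponents included. *)
Lemma zexpg_traj (X : Type) (f : Sym X) (s : int -> X) k :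
  (forall l, f (s l) = s (l + 1)) -> zexpg f k (s 0) = s k.
Proof.
move=> fs; elim/int_rec: k => [//|m IH|m IH].
  by rewrite -addn1 PoszD zexpgS symM IH fs.
apply: (@sym_inj _ f); rewrite fs -symM -zexpgS.
by rewrite -addn1 PoszD opprD subrK IH.
Qed.

(** The permutations U and T need not belong to the group generated by the sigma
    and tau, but each of their values is reached by an element of that group
    chosen pointwise; so their powers stay within the orbits of the group. *)
Lemma zexpg_orbit (X : Type) (K : set (Sym X)) (f : Sym X) k x :
  is_subgroup K -> (forall y, exists2 g, K g & g y = f y) ->
  exists2 g, K g & g x = zexpg f k x.
Proof.
move=> K_sg Kf; elim/int_rec: k => [|m [g gK gx]|m [g gK gx]].
- by exists 1%g => //; exact: K_sg.1.
- have [h hK hE] := Kf (g x); exists (h * g)%g; first exact: subgroup_mul.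
  by rewrite -addn1 PoszD zexpgS !symM hE gx.
have [h hK hE] := Kf ((f^-1)%g (g x)); exists (h^-1 * g)%g; first exact: K_sg.2.
rewrite -addn1 PoszD opprD addrC zexpgD zexpgN zexpg1 !symM -gx.
by apply: (@sym_inj _ h); rewrite symVK hE symVK.
Qed.

(** * Retraction classes, automorphisms and displacements *)

Section Solutions.
Variable X : solution.
Implicit Types (x y z : X) (f g h : Sym X).

Lemma ret_sigma_eq x y : ret_pi x = ret_pi y -> sigma x = sigma y.
Proof. by case/ret_piP. Qed.

Lemma ret_tau_eq x y : ret_pi x = ret_pi y -> tau x = tau y.
Proof. by case/ret_piP. Qed.

Lemma ret_pi_opposite x y :
  @ret_pi (opposite X) x = @ret_pi (opposite X) y <-> ret_pi x = ret_pi y.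
Proof. by rewrite !ret_piP /=; split=> -[]. Qed.

Lemma U_invE z : ((U_perm X)^-1)%g z = sigma (T_perm X z) z.
Proof. by []. Qed.

Lemma T_invE z : ((T_perm X)^-1)%g z = tau (U_perm X z) z.
Proof. by []. Qed.

(** As z = sigma_z(U z), the first Yang-Baxter identity at (z, U z) cancels to
    sigma_{tau_{U z}(z)} = sigma_{U z}, and tau_{U z}(z) is T^-1(z); for tau the
    same cancellation takes place in the opposite solution. *)
Lemma ret_T_inv z : ret_pi ((T_perm X)^-1%g z) = ret_pi (U_perm X z).
Proof.
apply/ret_piP; split; last exact: (@sigma_U_inv (opposite X) z).
apply: symP => w; apply: (@sym_inj _ (sigma z)).
rewrite T_invE; have := yb_sigma z (U_perm X z) w.
by rewrite [sigma z (U_perm X z)]symVK.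
Qed.

Lemma ret_sigma_inj x y z :
  ret_pi (sigma x y) = ret_pi (sigma x z) <-> ret_pi y = ret_pi z.
Proof. by rewrite -!ret_pi_rel ret_rel_sigma. Qed.

Definition Aut : set (Sym X) := [set f | @is_hom X X f].

Lemma Aut_conj_sigma f x : Aut f -> (sigma x ^ f)%g = sigma ((f^-1)%g x).
Proof.
move=> [fs _]; apply: symP => y; apply: (@sym_inj _ f).
by rewrite fs !symVK.
Qed.

Lemma Aut_conj_tau f x : Aut f -> (tau x ^ f)%g = tau ((f^-1)%g x).
Proof.
move=> [_ ft]; apply: symP => y; apply: (@sym_inj _ f).
by rewrite ft !symVK.
Qed.

Lemma Aut_subgroup : is_subgroup Aut.
Proof.
split=> [//|f g [fs ft] [gs gt]].
split=> y z; apply: (@sym_inj _ f); rewrite !symM ?fs ?ft !symVK.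
  exact: gs.
exact: gt.
Qed.

Lemma Aut_ret f x y : Aut f -> ret_pi x = ret_pi y -> ret_pi (f x) = ret_pi (f y).
Proof.
move=> [fs ft] xy; apply/ret_piP.
split; apply: symP => z; rewrite -(symVK f z).
  by rewrite -!fs (ret_sigma_eq xy).
by rewrite -!ft (ret_tau_eq xy).
Qed.

(** U is defined from the structure of X alone, hence every automorphism commutes
    with it. *)
Lemma Aut_U f : Aut f -> (f * U_perm X = U_perm X * f)%g.
Proof.
move=> [fs _]; apply: symP => x; rewrite !symM.
by apply: (@sym_inj _ (sigma (f x))); rewrite -fs !symVK.
Qed.

Lemma Dis_subgroup : is_subgroup (Dis X).
Proof. exact: subgroup_genP. Qed.

Lemma Dis_sigma x y : Dis X (sigma x * (sigma y)^-1)%g.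
Proof. by apply: sub_subgroup_gen; exists x, y; left. Qed.

Lemma Dis_tau x y : Dis X (tau x * (tau y)^-1)%g.
Proof. by apply: sub_subgroup_gen; exists x, y; right. Qed.

Lemma Dis_ind (A : set (Sym X)) :
  is_subgroup A -> (forall x y, A (sigma x * (sigma y)^-1)%g) ->
  (forall x y, A (tau x * (tau y)^-1)%g) -> Dis X `<=` A.
Proof.
move=> sgA As At; apply: subgroup_gen_min => // _ [x [y [->|->]]].
  exact: As.
exact: At.
Qed.

Lemma Aut_Dis f h : Aut f -> Dis X h -> Dis X (h ^ f)%g.
Proof.
move=> fA; apply: (@Dis_ind [set h | Dis X (h ^ f)%g]) h => [|x y|x y] /=.
- split=> [|g h /= gD hD] /=; first by rewrite conj1g; exact: Dis_subgroup.1.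
  by rewrite conjMg conjVg; apply: Dis_subgroup.2.
- by rewrite conjMg conjVg !Aut_conj_sigma //; exact: Dis_sigma.
- by rewrite conjMg conjVg !Aut_conj_tau //; exact: Dis_tau.
Qed.

(** Cosets of the stabiliser are the fibres of the orbit map at e; this turns
    every statement about Dis(X)/Dis(X)_e into one about points of X. *)
Lemma left_coset_stab e g :
  Dis X g ->
  left_coset g (Dis_stab e) = [set h | Dis X h /\ h e = g e].
Proof.
move=> gD; apply/seteqP; split=> [_ [h [hD he] <-]|h [hD he]] /=.
  split; first exact: subgroup_mul Dis_subgroup _ _.
  by rewrite -[in RHS]he.
exists (g^-1 * h)%g; last by rewrite mulVKg.
split; first exact: Dis_subgroup.2.
by rewrite symM he symK.
Qed.

(** Two iterated retraction classes agree exactly when the points act in the same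
    way on the classes of the first retraction. *)
Lemma mp_level_le2P :
  mp_level_le2 X <->
  (forall x y z, ret_pi (sigma x z) = ret_pi (sigma y z) /\
                 ret_pi (tau x z) = ret_pi (tau y z)).
Proof.
split=> [[p Xp] x y z|lvl2].
  have RX (a : Ret (Ret X)) : a = p by have : [set: Ret (Ret X)] a by []; rewrite Xp.
  have : ret_pi (ret_pi x : Ret X) = ret_pi (ret_pi y : Ret X).
    by rewrite [LHS]RX [RHS]RX.
  by case/ret_piP => /= es et; rewrite -!ret_sigmaE -!ret_tauE es et.
have [x0] := carrier_inhabited X.
exists (ret_pi (ret_pi x0 : Ret X)); apply/seteqP; split=> // a _ /=.
rewrite -(ret_reprK a); apply/ret_piP.
set b := ret_repr a; rewrite -(ret_reprK b).
by split; apply: symP => c; rewrite -(ret_reprK c) ?ret_sigmaE ?ret_tauE;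
  case: (lvl2 (ret_repr b) x0 (ret_repr c)).
Qed.

End Solutions.

Lemma is_hom_U (Y X : solution) (Phi : Y -> X) y :
  is_hom Phi -> Phi (U_perm Y y) = U_perm X (Phi y).
Proof.
move=> [Phis _]; apply: (@sym_inj _ (sigma (Phi y))).
by rewrite -Phis [sigma y _]symVK symVK.
Qed.

Lemma is_hom_T (Y X : solution) (Phi : Y -> X) y :
  is_hom Phi -> Phi (T_perm Y y) = T_perm X (Phi y).
Proof.
move=> [_ Phit]; apply: (@sym_inj _ (tau (Phi y))).
by rewrite -Phit [tau y _]symVK symVK.
Qed.

(** * Solutions of multipermutation level at most two *)

Section LevelTwo.
Variable X : solution.
Hypothesis lvl2 : mp_level_le2 X.
Implicit Types (x y z : X) (f g h : Sym X).

Lemma ret_sigma_const x y z : ret_pi (sigma x z) = ret_pi (sigma y z).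
Proof. by case: ((mp_level_le2P X).1 lvl2 x y z). Qed.

Lemma ret_tau_const x y z : ret_pi (tau x z) = ret_pi (tau y z).
Proof. by case: ((mp_level_le2P X).1 lvl2 x y z). Qed.

Lemma mp_level_le2_opposite : mp_level_le2 (opposite X).
Proof.
apply/mp_level_le2P => x y z; split; apply/ret_pi_opposite.
  exact: ret_tau_const.
exact: ret_sigma_const.
Qed.

Lemma ret_sigma_inv x z : ret_pi ((sigma x)^-1%g z) = ret_pi (U_perm X z).
Proof.
apply/(ret_sigma_inj x); rewrite symVK (ret_sigma_const x z).
by rewrite [sigma z _]symVK.
Qed.

(** For sigma, the Yang-Baxter identity at (x, z) gives
    U(sigma_x z) = sigma_{tau_z x}(U z), and tau_z(x) ~ T^-1(x) ~ U(x).  For tau,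
    a general identity gives U(tau_x z) = tau_y(U z) with y = sigma_{U z}^-1(x),
    and y ~ U(x) as well. *)
Lemma U_Aut : Aut (U_perm X).
Proof.
split=> x z; last first.
  rewrite [LHS]U_fun_tau; congr (_ _ _); apply: ret_tau_eq.
  exact: ret_sigma_inv.
have e : sigma (U_perm X x) = sigma (tau z x).
  apply: ret_sigma_eq; rewrite -ret_T_inv T_invE; exact: ret_tau_const.
rewrite e !U_permE; apply: (@sym_inj _ (sigma (sigma x z))).
by rewrite symVK -(yb_sigma x z) symVK.
Qed.

End LevelTwo.

Lemma T_Aut (X : solution) : mp_level_le2 X -> Aut (T_perm X).
Proof. by move=> /mp_level_le2_opposite/U_Aut[]. Qed.

Section LevelTwoTheory.
Variable X : solution.
Hypothesis lvl2 : mp_level_le2 X.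
Implicit Types (x y z : X) (f g h : Sym X).
Local Notation U := (U_perm X).
Local Notation T := (T_perm X).

(** The generators of Dis(X) apply one sigma and undo another, and at level at
    most two all sigma move classes in the same way. *)
Lemma Dis_ret h z : Dis X h -> ret_pi (h z) = ret_pi z.
Proof.
move=> hD; apply: (@Dis_ind X [set h | forall z, ret_pi (h z) = ret_pi z]) hD z.
- split=> [//|f g fR gR z] /=.
  by rewrite -(fR ((f^-1)%g (g z))) symVK gR.
- by move=> x y z; rewrite symM (ret_sigma_const lvl2 x y) symVK.
- by move=> x y z; rewrite symM (ret_tau_const lvl2 x y) symVK.
Qed.

Lemma Dis_sigma_inv h e : Dis X h -> (sigma e)^-1%g (h e) = U (h e).
Proof. by move=> hD; rewrite U_permE (ret_sigma_eq (Dis_ret e hD)). Qed.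

Lemma Dis_tau_inv h e : Dis X h -> (tau e)^-1%g (h e) = T (h e).
Proof. by move=> hD; rewrite T_permE (ret_tau_eq (Dis_ret e hD)). Qed.

Lemma U_pow_Aut k : Aut (zexpg U k).
Proof. by apply: zexpg_subgroup; [exact: Aut_subgroup | exact: U_Aut]. Qed.

Lemma T_pow_Aut k : Aut (zexpg T k).
Proof. by apply: zexpg_subgroup; [exact: Aut_subgroup | exact: T_Aut]. Qed.

(** Replace f by g one factor at a time; powers of the automorphism g preserve
    the equality of classes obtained so far. *)
Lemma ret_zexpg f g k z :
  Aut g -> (forall y, ret_pi (f y) = ret_pi (g y)) ->
  ret_pi (zexpg f k z) = ret_pi (zexpg g k z).
Proof.
move=> gA fg; have gVA : Aut (g^-1)%g by exact: subgroup_inv (@Aut_subgroup X) _.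
have fgV y : ret_pi ((f^-1)%g y) = ret_pi ((g^-1)%g y).
  by rewrite -(symK g ((f^-1)%g y)); apply: Aut_ret => //; rewrite -fg symVK.
elim/int_rec: k => [//|m IH|m IH].
  by rewrite -addn1 PoszD !zexpgS !symM fg; exact: Aut_ret.
rewrite -addn1 PoszD opprD addrC !zexpgD !zexpgN !zexpg1 !symM fgV.
by rewrite -!zexpgN; exact: Aut_ret.
Qed.

Lemma ret_T_pow k z : ret_pi (zexpg T k z) = ret_pi (zexpg U (- k) z).
Proof.
have UVA : Aut (U^-1)%g by exact: subgroup_inv (Aut_subgroup X) (U_Aut lvl2).
rewrite -zexpgV; apply: ret_zexpg => // y.
by rewrite -[T y](symK U); apply: Aut_ret => //; rewrite -ret_T_inv symK.
Qed.

End LevelTwoTheory.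

(** * Coordinates by powers of U and T *)

Section LevelTwoOrbits.
Variable X : solution.
Hypothesis lvl2 : mp_level_le2 X.
Implicit Types (x y z e : X) (f g h : Sym X).
Local Notation U := (U_perm X).
Local Notation T := (T_perm X).

(** The exponents are negated because on S(G x Z_n^2, c, d) it is U^-1 and T^-1
    that add one to the index coordinates. *)
Definition UT_shift (k l : int) : Sym X := (zexpg U (- k) * zexpg T (- l))%g.

Lemma UT_shift_Aut k l : Aut (UT_shift k l).
Proof.
by apply: subgroup_mul; [exact: Aut_subgroup|exact: U_pow_Aut|exact: T_pow_Aut].
Qed.

Lemma UT_shiftD k l k' l' :
  UT_shift (k + k') (l + l') = (UT_shift k l * UT_shift k' l')%g.
Proof.
have wU := zexpg_commute (- k') (Aut_U (UT_shift_Aut k l)).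
by rewrite mulgA wU /UT_shift !opprD [- k + _]addrC !zexpgD !mulgA.
Qed.

Lemma UT_shift00 : UT_shift 0 0 = 1%g.
Proof. exact: mulg1. Qed.

Lemma UT_shiftN k l : UT_shift (- k) (- l) = (UT_shift k l)^-1%g.
Proof.
apply: (can_inj (mulKg (UT_shift k l))).
by rewrite -UT_shiftD !subrr mulgV UT_shift00.
Qed.

Lemma UT_shift10 : UT_shift 1 0 = (U^-1)%g.
Proof. by rewrite /UT_shift zexpgN zexpg1 mulg1. Qed.

Lemma UT_shift01 : UT_shift 0 1 = (T^-1)%g.
Proof. by rewrite /UT_shift [zexpg T _]zexpgN zexpg1 mul1g. Qed.

Lemma ret_UT_shift k l x : ret_pi (UT_shift k l x) = ret_pi (zexpg U (l - k) x).
Proof.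
rewrite /UT_shift addrC zexpgD !symM.
by apply: Aut_ret; [exact: U_pow_Aut|rewrite ret_T_pow // opprK].
Qed.

Lemma ret_UT_shift_inv k l k' l' x :
  ret_pi ((UT_shift k l)^-1%g (UT_shift k' l' x)) =
  ret_pi (zexpg U (l' - l - (k' - k)) x).
Proof.
by rewrite -UT_shiftN -symM -UT_shiftD ret_UT_shift ![- _ + _]addrC.
Qed.

(** Write w for U^-k' T^-l'.  As w is an automorphism, it can be moved out of
    the left-hand side, which leaves w sigma_y(h' e) with y ~ U^-m(e) for
    m = k - l + l' - k'.  On the right, the factor U^-1 that raises k' by one
    cancels against sigma_e^-1, since sigma_e^-1 h'(e) = U h'(e); moving it past
    sigma changes the index m - 1 into m. *)
Lemma sigma_UT_shift e k l k' l' h h' : Dis X h -> Dis X h' ->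
  sigma (UT_shift k l (h e)) (UT_shift k' l' (h' e)) =
  UT_shift (k' + 1) l'
    (sigma (zexpg U (- (k - l + l' - k' - 1)) e) ((sigma e)^-1%g (h' e))).
Proof.
move=> hD h'D; have [ws _] := UT_shift_Aut k' l'.
have UVA : Aut (U^-1)%g by exact: subgroup_inv (@Aut_subgroup X) (U_Aut lvl2).
have -> : UT_shift (k' + 1) l' = (UT_shift k' l' * U^-1)%g.
  by rewrite -UT_shift10 -UT_shiftD addr0.
rewrite symM UVA.1 Dis_sigma_inv // symK.
rewrite -[in LHS](symVK (UT_shift k' l') (UT_shift k l _)) -ws.
congr (UT_shift k' l' (sym_fun _ _)); apply: ret_sigma_eq.
rewrite ret_UT_shift_inv -[U in (U^-1)%g]zexpg1 -zexpgN -[in RHS]symM -zexpgD.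
rewrite (Aut_ret (U_pow_Aut lvl2 _) (Dis_ret lvl2 e hD)).
by congr (ret_pi (zexpg U _ e)); ring.
Qed.

(** As for sigma, now with T^-1 cancelling against tau_e^-1; the exponent m is
    positive because T acts on classes as U^-1. *)
Lemma tau_UT_shift e k l k' l' h h' : Dis X h -> Dis X h' ->
  tau (UT_shift k l (h e)) (UT_shift k' l' (h' e)) =
  UT_shift k' (l' + 1)
    (tau (zexpg T (k - l + l' - k' + 1) e) ((tau e)^-1%g (h' e))).
Proof.
move=> hD h'D; have [_ wt] := UT_shift_Aut k' l'.
have TVA : Aut (T^-1)%g by exact: subgroup_inv (@Aut_subgroup X) (T_Aut lvl2).
have -> : UT_shift k' (l' + 1) = (UT_shift k' l' * T^-1)%g.
  by rewrite -UT_shift01 -UT_shiftD addr0.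
rewrite symM TVA.2 Dis_tau_inv // symK.
rewrite -[in LHS](symVK (UT_shift k' l') (UT_shift k l _)) -wt.
congr (UT_shift k' l' (sym_fun _ _)); apply: ret_tau_eq.
rewrite ret_UT_shift_inv -[T in (T^-1)%g]zexpg1 -zexpgN -[in RHS]symM -zexpgD.
rewrite (Aut_ret (U_pow_Aut lvl2 _) (Dis_ret lvl2 e hD)) ret_T_pow //.
by congr (ret_pi (zexpg U _ e)); ring.
Qed.

(** The points of this form are stable under Dis(X), which is normalised by the
    automorphisms U and T, and under the powers of U and T; and sigma_y(x) is
    obtained from U^-1(x) = sigma_{T x}(x) by the displacement
    sigma_y sigma_{T x}^-1. *)
Lemma indecomposable_UT_shift e : indecomposable X ->
  forall x, exists k l h, Dis X h /\ x = UT_shift k l (h e).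
Proof.
move=> indec.
pose O := [set x | exists k l h, Dis X h /\ x = UT_shift k l (h e)].
(* Asking for an equivalence makes this a group, inverses included. *)
pose stabO := [set g : Sym X | forall x, O (g x) <-> O x].
pose W := [set w | exists k l, w = UT_shift k l].
have stabO_sg : is_subgroup stabO.
  split=> [//|f g fO gO x]; rewrite symM.
  by rewrite -(fO ((f^-1)%g (g x))) symVK; exact: gO.
have W_sg : is_subgroup W.
  split=> [|_ _ [k [l ->]] [k' [l' ->]]]; first by exists 0, 0; rewrite UT_shift00.
  by exists (- k + k'), (- l + l'); rewrite UT_shiftD UT_shiftN.
have stable A : is_subgroup A -> (forall g x, A g -> O x -> O (g x)) -> A `<=` stabO.
  move=> A_sg AO g gA x; split=> [Ogx|]; last exact: AO.
  by rewrite -(symK g x); apply: AO => //; exact: subgroup_inv.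
have DisO : Dis X `<=` stabO.
  apply: stable => [|g x gD [k [l [h [hD ->]]]]]; first exact: Dis_subgroup.
  exists k, l, (g ^ UT_shift k l * h)%g; split.
    apply: subgroup_mul (@Dis_subgroup X) _ hD.
    exact: Aut_Dis (UT_shift_Aut k l) gD.
  by rewrite -!symM conjgE !mulgA mulgV mul1g.
have WO : W `<=` stabO.
  apply: stable => // _ _ [k [l ->]] [k' [l' [h [hD ->]]]].
  by exists (k + k'), (l + l'), h; rewrite UT_shiftD.
have genO : subgroup_gen (range (@sigma X) `|` range (@tau X)) `<=` stabO.
  apply: subgroup_gen_min => // _ [[y _ <-]|[y _ <-]].
  - move=> x; have -> : sigma y x = (sigma y * (sigma (T x))^-1)%g ((U^-1)%g x).
      by rewrite symM U_invE symK.
    rewrite (DisO _ (Dis_sigma _ _)); apply: WO.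
    by exists 1, 0; rewrite UT_shift10.
  - move=> x; have -> : tau y x = (tau y * (tau (U x))^-1)%g ((T^-1)%g x).
      by rewrite symM T_invE symK.
    rewrite (DisO _ (Dis_tau _ _)); apply: WO.
    by exists 0, 1; rewrite UT_shift01.
move=> x; have [g /genO gO <-] := indec e x; apply/(gO e).
by exists 0, 0, 1%g; rewrite UT_shift00; split=> //; exact: (Dis_subgroup X).1.
Qed.

End LevelTwoOrbits.

(** * Covering a solution by S(G x Z_n^2, c, d) *)

Section Covering.
Variables (X : solution) (G : zmodType) (n : option nat).
Hypothesis n_pos : n <> Some 0%N.
Variables c d : Zn n -> G.
Hypotheses (c0 : c 0 = 0) (d0 : d 0 = 0).
Local Notation U := (U_perm X).
Local Notation T := (T_perm X).
Local Notation one := (Zn_one n).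

Definition S_point (a : G) (i i' : Zn n) : S_solution c d := (a, i, i').

Lemma S_sigmaE a i i' b j j' :
  sigma (S_point a i i') (S_point b j j') =
  S_point (b + c (i - i' + j' - j - one)) (j + one) j'.
Proof. by []. Qed.

Lemma S_tauE a i i' b j j' :
  tau (S_point a i i') (S_point b j j') =
  S_point (b + d (i - i' + j' - j + one)) j (j' + one).
Proof. by []. Qed.

Section Sufficiency.
Variables (e : X) (phi : G -> set (Sym X)).
Hypotheses (indec : indecomposable X) (lvl2 : mp_level_le2 X).
Hypotheses (U_dvd : order_dvd (ext_order U) n) (T_dvd : order_dvd (ext_order T) n).
Hypothesis phi_hom : surjective_hom_to_quotient (Dis X) (Dis_stab e) phi.
Hypothesis phi_cd : forall (i : Zn n) (k : int), Zn_class n k = i ->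
  phi (c i) = left_coset
    (sigma (zexpg U (- k) e) * (sigma e)^-1)%g (Dis_stab e) /\
  phi (d i) = left_coset
    (tau (zexpg T k e) * (tau e)^-1)%g (Dis_stab e).

(** The map sends (a, i, i') to U^-i T^-i' h(e) with h in the coset phi(a).
    Adding c_m or d_m to the first coordinate multiplies h by the displacement
    that represents phi(c_m) or phi(d_m), and with this the formulas for sigma
    and tau on both sides agree. *)
Lemma image_of_S : homomorphic_image X (S_solution c d).
Proof.
have [phi_range phiD] := phi_hom.
have /choice[rep rep_phi] (a : G) :
    exists h, Dis X h /\ phi a = left_coset h (Dis_stab e).
  have : left_cosets (Dis X) (Dis_stab e) (phi a) by rewrite -phi_range; exists a.
  by case=> h hD <-; exists h.
have /choice[zlift zliftP] (i : Zn n) : exists k, Zn_class n k = i.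
  exact: Zn_class_surj.
have coset1 g : left_coset g (Dis_stab e) g.
  exists 1%g; last by rewrite mulg1.
  by split=> //; exact: (Dis_subgroup X).1.
(* The values of phi multiply as sets, and only the value at e of an element of
   a coset matters. *)
have repD a b g : phi b = left_coset g (Dis_stab e) -> rep (a + b) e = g (rep a e).
  move=> phi_b; have [abD phi_ab] := rep_phi (a + b).
  have : phi (a + b) (g * rep a)%g.
    rewrite addrC phiD; exists g; first by rewrite phi_b.
    by exists (rep a) => //; rewrite (rep_phi a).2.
  by rewrite phi_ab left_coset_stab // => -[_ <-].
pose Phi (y : S_solution c d) : X :=
  UT_shift X (zlift y.1.2) (zlift y.2) (rep y.1.1 e).
have PhiE a k k' :
    Phi (S_point a (Zn_class n k) (Zn_class n k')) = UT_shift X k k' (rep a e).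
  rewrite /Phi /UT_shift /=.
  rewrite (((order_dvdP n_pos U).1 U_dvd) _ (- k)); last by rewrite !Zn_classN zliftP.
  by rewrite (((order_dvdP n_pos T).1 T_dvd) _ (- k')) // !Zn_classN zliftP.
exists Phi; split; first split.
- move=> [[a i] i'] [[b j] j'].
  have [k ki] := Zn_class_surj i; have [k' ki'] := Zn_class_surj i'.
  have [l lj] := Zn_class_surj j; have [l' lj'] := Zn_class_surj j'.
  rewrite -/(S_point a i i') -/(S_point b j j') S_sigmaE -ki -ki' -lj -lj'.
  rewrite -Zn_class1 -!Zn_classN -!Zn_classD !PhiE.
  have [aD _] := rep_phi a; have [bD _] := rep_phi b.
  by rewrite sigma_UT_shift // (repD _ _ _ (phi_cd erefl).1).
- move=> [[a i] i'] [[b j] j'].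
  have [k ki] := Zn_class_surj i; have [k' ki'] := Zn_class_surj i'.
  have [l lj] := Zn_class_surj j; have [l' lj'] := Zn_class_surj j'.
  rewrite -/(S_point a i i') -/(S_point b j j') S_tauE -ki -ki' -lj -lj'.
  rewrite -Zn_class1 -!Zn_classN -!Zn_classD !PhiE.
  have [aD _] := rep_phi a; have [bD _] := rep_phi b.
  by rewrite tau_UT_shift // (repD _ _ _ (phi_cd erefl).2).
move=> x; have [k [l [h [hD ->]]]] := indecomposable_UT_shift lvl2 e indec x.
have [a _ phi_a] : range phi (left_coset h (Dis_stab e)).
  by rewrite phi_range; exists h.
exists (S_point a (Zn_class n k) (Zn_class n l)); rewrite PhiE.
have : phi a (rep a) by rewrite (rep_phi a).2.
by rewrite phi_a left_coset_stab // => -[_ ->].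
Qed.

End Sufficiency.

(** * Homomorphic images of S(G x Z_n^2, c, d) *)

Section Necessity.
Hypothesis G_gen : add_subgroup_gen (range c `|` range d) = [set: G].
Variable Phi : S_solution c d -> X.
Hypotheses (Phi_hom : is_hom Phi) (Phi_surj : forall x, exists y, Phi y = x).

Lemma S_U a i i' :
  U_perm (S_solution c d) (S_point a i i') = S_point a (i - one) i'.
Proof.
apply: (@sym_inj _ (sigma (S_point a i i'))).
rewrite [LHS]symVK S_sigmaE.
have -> : i - i' + i' - (i - one) - one = 0.
  by rewrite subrK -addrA -opprD subrK subrr.
by rewrite c0 addr0 subrK.
Qed.

Lemma S_T a i i' :
  T_perm (S_solution c d) (S_point a i i') = S_point a i (i' - one).
Proof.
apply: (@sym_inj _ (tau (S_point a i i'))).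
rewrite [LHS]symVK S_tauE.
have -> : i - i' + (i' - one) - i + one = 0.
  by rewrite addrA subrK -addrA [- i + one]addrC addrA subrK subrr.
by rewrite d0 addr0 subrK.
Qed.

Lemma U_image a i i' k :
  zexpg U k (Phi (S_point a i i')) = Phi (S_point a (i - Zn_class n k) i').
Proof.
pose s k := Phi (S_point a (i - Zn_class n k) i').
have -> : Phi (S_point a i i') = s 0 by rewrite /s Zn_class0 subr0.
apply: (@zexpg_traj _ U s) => {}k; rewrite /s -is_hom_U //; congr Phi.
by rewrite S_U Zn_classD Zn_class1 opprD addrA.
Qed.

Lemma T_image a i i' k :
  zexpg T k (Phi (S_point a i i')) = Phi (S_point a i (i' - Zn_class n k)).
Proof.
pose s k := Phi (S_point a i (i' - Zn_class n k)).
have -> : Phi (S_point a i i') = s 0 by rewrite /s Zn_class0 subr0.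
apply: (@zexpg_traj _ T s) => {}k; rewrite /s -is_hom_T //; congr Phi.
by rewrite S_T Zn_classD Zn_class1 opprD addrA.
Qed.

Lemma sigma_image a i i' b j j' :
  sigma (Phi (S_point a i i')) (Phi (S_point b j j')) =
  Phi (S_point (b + c (i - i' + j' - j - one)) (j + one) j').
Proof. by rewrite -Phi_hom.1. Qed.

Lemma tau_image a i i' b j j' :
  tau (Phi (S_point a i i')) (Phi (S_point b j j')) =
  Phi (S_point (b + d (i - i' + j' - j + one)) j (j' + one)).
Proof. by rewrite -Phi_hom.2. Qed.

Lemma image_ind (P : X -> Prop) :
  (forall a i i', P (Phi (S_point a i i'))) -> forall x, P x.
Proof. by move=> PPhi x; have [[[a i] i'] <-] := Phi_surj x; exact: PPhi. Qed.

(** On S the maps sigma and tau of a point depend on its index coordinates only,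
    and the index coordinates of sigma_x(z) and tau_x(z) do not depend on x. *)
Lemma image_level2 : mp_level_le2 X.
Proof.
apply/mp_level_le2P => x y z.
elim/image_ind: x => a i i'; elim/image_ind: y => b j j'.
elim/image_ind: z => g k k'.
rewrite !sigma_image !tau_image !ret_piP.
by split; split; apply: symP => w; elim/image_ind: w => h l l';
  rewrite ?sigma_image ?tau_image.
Qed.

Lemma image_order_U : order_dvd (ext_order U) n.
Proof.
apply/order_dvdP => // k l kl; apply: symP => x.
by elim/image_ind: x => a i i'; rewrite !U_image kl.
Qed.

Lemma image_order_T : order_dvd (ext_order T) n.
Proof.
apply/order_dvdP => // k l kl; apply: symP => x.
by elim/image_ind: x => a i i'; rewrite !T_image kl.
Qed.

(** In S(G x Z_n^2, c, d) a displacement adds to (b, j, j') an element of G that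
    depends on the difference of the two indices; tracking its effect where both
    indices vanish is enough, since this part of the image contains the orbit of
    the base point under Dis(X). *)
Definition translation (g : Sym X) (t : G) :=
  forall b, g (Phi (S_point b 0 0)) = Phi (S_point (b + t) 0 0).

Lemma translation_inv g t : translation g t -> translation (g^-1)%g (- t).
Proof.
by move=> gt b; apply: (@sym_inj _ g); rewrite symVK gt subrK.
Qed.

Lemma translationM g h s t :
  translation g s -> translation h t -> translation (g * h)%g (t + s).
Proof. by move=> gs ht b; rewrite symM ht gs addrA. Qed.

(** A permutation sigma of S takes (_, -1, 0) to (_, 0, 0), adding the entry of c
    at the difference of the indices of its label. *)
Lemma sigma_div_translation a i i' b j j' :
  translation (sigma (Phi (S_point a i i')) * (sigma (Phi (S_point b j j')))^-1)%g
    (c (i - i') - c (j - j')).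
Proof.
move=> g; rewrite symM.
have -> : Phi (S_point g 0 0) = sigma (Phi (S_point b j j'))
                                  (Phi (S_point (g - c (j - j')) (- one) 0)).
  by rewrite sigma_image addr0 opprK addrK subrK addNr.
by rewrite symK sigma_image addr0 opprK addrK addNr addrAC addrA.
Qed.

(** Here the intermediate point is (_, 0, -1). *)
Lemma tau_div_translation a i i' b j j' :
  translation (tau (Phi (S_point a i i')) * (tau (Phi (S_point b j j')))^-1)%g
    (d (i - i') - d (j - j')).
Proof.
move=> g; rewrite symM.
have -> : Phi (S_point g 0 0) = tau (Phi (S_point b j j'))
                                  (Phi (S_point (g - d (j - j')) 0 (- one))).
  by rewrite tau_image subr0 subrK subrK addNr.
by rewrite symK tau_image subr0 subrK addNr addrAC addrA.
Qed.

Lemma Dis_translation g : Dis X g -> exists t, translation g t.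
Proof.
move: g; apply: Dis_ind => [|x y|x y].
- split=> [|g h [s gs] [t ht]]; first by exists 0 => b; rewrite addr0.
  by exists (t - s); apply: translationM => //; exact: translation_inv.
- elim/image_ind: x => a i i'; elim/image_ind: y => b j j'.
  by exists (c (i - i') - c (j - j')); exact: sigma_div_translation.
- elim/image_ind: x => a i i'; elim/image_ind: y => b j j'.
  by exists (d (i - i') - d (j - j')); exact: tau_div_translation.
Qed.

(** The translations that occur form a subgroup, which contains each c_i and d_i
    because c_0 = d_0 = 0. *)
Lemma translation_Dis t : exists2 g, Dis X g & translation g t.
Proof.
pose D := [set t | exists2 g, Dis X g & translation g t].
suff : add_subgroup_gen (range c `|` range d) `<=` D by rewrite G_gen; exact.
apply: smallest_sub.
  split=> [|s r [g gD gs] [h hD hr]].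
    exists 1%g; first exact: (Dis_subgroup X).1.
    by move=> b; rewrite addr0.
  exists (h^-1 * g)%g; first exact: (Dis_subgroup X).2.
  by apply: translationM => //; exact: translation_inv.
move=> _ [[i _ <-]|[i _ <-]].
  exists (sigma (Phi (S_point 0 i 0)) * (sigma (Phi (S_point 0 0 0)))^-1)%g.
    exact: Dis_sigma.
  by have := sigma_div_translation 0 i 0 0 0 0; rewrite !subr0 c0 subr0.
exists (tau (Phi (S_point 0 i 0)) * (tau (Phi (S_point 0 0 0)))^-1)%g.
  exact: Dis_tau.
by have := tau_div_translation 0 i 0 0 0 0; rewrite !subr0 d0 subr0.
Qed.

(** The first coordinate is changed by displacements and the other two by the
    powers of U and T, whose values sigma_x^-1(x) and tau_x^-1(x) stay within
    the orbits. *)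
Lemma image_indecomposable : indecomposable X.
Proof.
set K := subgroup_gen (range (@sigma X) `|` range (@tau X)).
have K_sg : is_subgroup K by exact: subgroup_genP.
have Ks x : K (sigma x) by apply: sub_subgroup_gen; left; exists x.
have Kt x : K (tau x) by apply: sub_subgroup_gen; right; exists x.
have DisK : Dis X `<=` K.
  apply: (Dis_ind K_sg) => x y.
    exact: subgroup_mul K_sg (Ks x) (subgroup_inv K_sg (Ks y)).
  exact: subgroup_mul K_sg (Kt x) (subgroup_inv K_sg (Kt y)).
suff Ke x : exists2 g, K g & g (Phi (S_point 0 0 0)) = x.
  move=> x y; have [g gK <-] := Ke x; have [h hK <-] := Ke y.
  exists (h * g^-1)%g; last by rewrite symM symK.
  exact: subgroup_mul K_sg hK (subgroup_inv K_sg gK).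
elim/image_ind: x => a i i'.
have [k ki] := Zn_class_surj (- i); have [k' ki'] := Zn_class_surj (- i').
have [h hD ht] := translation_Dis a.
have [f fK fE] : exists2 f, K f & f (Phi (S_point a 0 0)) = Phi (S_point a i 0).
  have -> : Phi (S_point a i 0) = zexpg U k (Phi (S_point a 0 0)).
    by rewrite U_image ki opprK add0r.
  apply: zexpg_orbit => // x; exists (sigma x)^-1%g => //.
  exact: subgroup_inv K_sg (Ks x).
have [f' fK' fE'] : exists2 f, K f & f (Phi (S_point a i 0)) = Phi (S_point a i i').
  have -> : Phi (S_point a i i') = zexpg T k' (Phi (S_point a i 0)).
    by rewrite T_image ki' opprK add0r.
  apply: zexpg_orbit => // x; exists (tau x)^-1%g => //.
  exact: subgroup_inv K_sg (Kt x).
exists (f' * (f * h))%g; last by rewrite !symM ht add0r fE fE'.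
exact: subgroup_mul K_sg fK' (subgroup_mul K_sg fK (DisK _ hD)).
Qed.

(** The point Phi(a,0,0) determines a coset of the stabiliser of
    e = Phi(0,0,0); all the elements of Dis(X) in the proof are translations, so
    they add up as their translation lengths do. *)
Lemma image_quotient_hom : exists (e : X) (phi : G -> set (Sym X)),
  surjective_hom_to_quotient (Dis X) (Dis_stab e) phi /\
  forall (i : Zn n) (k : int), Zn_class n k = i ->
    phi (c i) = left_coset
      (sigma (zexpg U (- k) e) * (sigma e)^-1)%g (Dis_stab e) /\
    phi (d i) = left_coset
      (tau (zexpg T k e) * (tau e)^-1)%g (Dis_stab e).
Proof.
set e := Phi (S_point 0 0 0).
pose phi a : set (Sym X) := [set g | Dis X g /\ g e = Phi (S_point a 0 0)].
have phiE g a : Dis X g -> g e = Phi (S_point a 0 0) ->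
    phi a = left_coset g (Dis_stab e).
  by move=> gD ge; rewrite left_coset_stab // ge.
exists e, phi; split; first split.
- apply/seteqP; split=> [_ [a _ <-]|_ [g gD <-]].
    have [g gD gt] := translation_Dis a; exists g => //.
    by rewrite (phiE g) // gt add0r.
  have [t gt] := Dis_translation gD.
  by exists t => //; apply: phiE => //; rewrite gt add0r.
- move=> a b; apply/seteqP; split=> [h [hD he]|_ [g [gD ge] [h [hD he] <-]]].
    have [k kD kt] := translation_Dis b.
    have [t ht] := Dis_translation hD.
    exists (h * k^-1)%g; last by exists k; [split; rewrite // kt add0r|rewrite mulgVK].
    split; first exact: subgroup_mul (Dis_subgroup X) hD (subgroup_inv (Dis_subgroup X) kD).
    apply: (@sym_inj _ k); rewrite kt -he ht.
    rewrite symM /e (translation_inv kt) ht kt.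
    by rewrite add0r addrAC addNr.
  split; first exact: subgroup_mul (Dis_subgroup X) _ _.
  have [k kD kt] := translation_Dis b.
  have [t gt] := Dis_translation gD.
  have ta : Phi (S_point t 0 0) = Phi (S_point a 0 0) by rewrite -ge gt add0r.
  by rewrite symM he gt [b + t]addrC -(kt t) ta kt.
move=> i k <-; split; apply: phiE.
- exact: Dis_sigma.
- by rewrite U_image Zn_classN opprK sigma_div_translation !subr0 !add0r c0 subr0.
- exact: Dis_tau.
- by rewrite T_image tau_div_translation !subr0 !add0r opprK d0 subr0.
Qed.

End Necessity.

End Covering.

Theorem proposition6p1 (X : solution) (G : zmodType) (n : option nat)
    (n_pos : n <> Some 0%N) (c d : Zn n -> G)
    (c0 : c 0 = 0) (d0 : d 0 = 0)
    (G_gen : add_subgroup_gen (range c `|` range d) = [set: G]) :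
  homomorphic_image X (S_solution c d) <->
  (indecomposable X /\
   mp_level_le2 X /\
   order_dvd (ext_order (U_perm X)) n /\
   order_dvd (ext_order (T_perm X)) n /\
   exists (e : X) (phi : G -> set (Sym X)),
     surjective_hom_to_quotient (Dis X) (Dis_stab e) phi /\
     forall (i : Zn n) (k : int), Zn_class n k = i ->
       phi (c i) = left_coset
         (sigma (zexpg (U_perm X) (- k) e) * (sigma e)^-1)%g (Dis_stab e) /\
       phi (d i) = left_coset
         (tau (zexpg (T_perm X) k e) * (tau e)^-1)%g (Dis_stab e)).
Proof.
split=> [[Phi [Phi_hom Phi_surj]]|[indec [lvl2 [U_dvd [T_dvd [e [phi [phi_hom phi_cd]]]]]]]].
  split; first exact: (image_indecomposable c0 d0 G_gen Phi_hom Phi_surj).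
  split; first exact: (image_level2 Phi_hom Phi_surj).
  split; first exact: (image_order_U n_pos c0 Phi_hom Phi_surj).
  split; first exact: (image_order_T n_pos d0 Phi_hom Phi_surj).
  exact: (image_quotient_hom c0 d0 G_gen Phi_hom Phi_surj).
exact: (image_of_S n_pos indec lvl2 U_dvd T_dvd phi_hom phi_cd).
Qed.
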